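(* Let $r\ge1$ be an integer and let $g\in C^{r}[c,d]$. Then, for every grid node $z_j$, $j=0,1,\dots,n$, $$\widetilde{T}_{n,r}(g,z_j)=g(z_j).$$
   Context: Setting. $[c,d]\subset\mathbb{R}$ is a compact interval, functions are real-valued, and $C^{r}[c,d]$ is the space of functions whose derivatives up to order $r$ exist and are continuous on $[c,d]$. Irregular grid. $c=z_0<z_1<\cdots<z_n=d$ is a partition with $0<d_1\le z_{k+1}-z_k\le d_2$ for $k=0,\dots,n-1$, where $d_2<2d_1$; here $d_1=\min_k(z_{k+1}-z_k)$ is the minimum mesh size. Activation. For $m>0$, $D(m)$ is the class of measurable functions $\eta:\mathbb{R}\to\mathbb{R}$ that are increasing (i.e. non-decreasing), with $\eta(y)=0$ for $y\le -m$, $\eta(y)=1$ for $y\ge m$, and $0<\eta(y)<1$ for $-m<y<m$. Fix $\eta\in D(m)$ and put $\sigma(y):=\eta(y+m)-\eta(y-m)$, $y\in\mathbb{R}$. Operator. For $g\in C^r[c,d]$ let $P_r(g;y,z_k):=\sum_{j=0}^{r}\frac{g^{(j)}(z_k)}{j!}(y-z_k)^j$ and $$\widetilde{T}_{n,r}(g,y):=\frac{\sum_{k=0}^{n}\sigma\!\left(\frac{2m}{d_1}(y-z_k)\right)P_r(g;y,z_k)}{\sum_{k=0}^{n}\sigma\!\left(\frac{2m}{d_1}(y-z_k)\right)},\qquad y\in[c,d].$$ *)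

(* Defs.v *)
From HB Require Import structures.
From mathcomp Require Import all_boot all_order all_algebra.
From mathcomp Require Import all_classical all_reals all_analysis.

Set Implicit Arguments.
Unset Strict Implicit.
Unset Printing Implicit Defensive.

Import Order.TTheory GRing.Theory Num.Theory.
Import numFieldNormedType.Exports.

Local Open Scope classical_set_scope.
Local Open Scope ring_scope.

Section RelativeDerivatives.
Variable R : realType.

Definition diff_quotient (f : R -> R) (x y : R) : R := (f y - f x) / (y - x).

(* Only the values of f on A matter: at an endpoint of A = [c, d] these are
   one-sided derivatives. When the limit does not exist, derive_in is an
   unspecified value, hence the separate predicate derivable_in. *)
Definition derivable_in (A : set R) (f : R -> R) (x : R) : Prop :=
  cvg (diff_quotient f x y @[y --> within A x^']).

Definition derive_in (A : set R) (f : R -> R) (x : R) : R :=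
  lim (diff_quotient f x y @[y --> within A x^']).

Definition deriven_in (A : set R) (j : nat) (f : R -> R) : R -> R :=
  iter j (derive_in A) f.

Definition Cr_itv (c d : R) (r : nat) (f : R -> R) : Prop :=
  (forall j x, (j < r)%N -> x \in `[c, d] ->
     derivable_in `[c, d] (deriven_in `[c, d] j f) x) /\
  (forall j, (j <= r)%N -> {within `[c, d], continuous (deriven_in `[c, d] j f)}).

End RelativeDerivatives.

Section Operator.
Variable R : realType.

(* Only z 0, ..., z n matter. The last clause, with the lower bound d1 of the
   one before it, says that d1 is the minimum of the mesh sizes. *)
Definition irregular_grid (c d : R) (n : nat) (z : nat -> R) (d1 d2 : R) : Prop :=
  [/\ (0 < n)%N, z 0%N = c /\ z n = d, 0 < d1 /\ d2 < 2 * d1,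
      forall k, (k < n)%N -> d1 <= z k.+1 - z k <= d2
    & exists2 k, (k < n)%N & z k.+1 - z k = d1].

Definition classD (m : R) (eta : R -> R) : Prop :=
  [/\ measurable_fun setT eta, {homo eta : x y / x <= y},
      forall y, y <= - m -> eta y = 0,
      forall y, m <= y -> eta y = 1
    & forall y, - m < y < m -> 0 < eta y < 1].

Definition bump_of (m : R) (eta : R -> R) (y : R) : R := eta (y + m) - eta (y - m).

Definition taylor_in (A : set R) (r : nat) (g : R -> R) (y x : R) : R :=
  \sum_(j < r.+1) deriven_in A j g x / (j`!)%:R * (y - x) ^+ j.

Definition Ttilde (m : R) (eta : R -> R) (c d : R) (n : nat) (z : nat -> R)
    (d1 : R) (r : nat) (g : R -> R) (y : R) : R :=
  (\sum_(k < n.+1) bump_of m eta (2 * m / d1 * (y - z k))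
                   * taylor_in `[c, d] r g y (z k))
  / (\sum_(k < n.+1) bump_of m eta (2 * m / d1 * (y - z k))).

End Operator.

(* Main.v *)
(** At a node [z j] the bump centred at [z j] takes the value 1, while every other
    node is at distance at least [d1], so that its rescaled argument has modulus at
    least [2 m], where the bump vanishes. Only the Taylor polynomial based
    at [z j] survives, and at its own base point it equals [g (z j)]. *)
Require Import Defs.
From mathcomp Require Import all_boot all_order all_algebra.
From mathcomp Require Import all_classical all_reals all_analysis.
From mathcomp Require Import lra.
Import Order.TTheory GRing.Theory Num.Theory.
Import numFieldNormedType.Exports.
Local Open Scope classical_set_scope.
Local Open Scope ring_scope.

Lemma bump_of0 (R : realType) (m : R) (eta : R -> R) :
  classD m eta -> bump_of m eta 0 = 1.
Proof.
by case=> _ _ eta0 eta1 _; rewrite /bump_of add0r sub0r (eta0 (- m)) // eta1 // subr0.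
Qed.

(** Both [y + m] and [y - m] then lie in the same constant region of [eta]. The bound is non-strict
    because adjacent nodes may be exactly [d1] apart. *)
Lemma bump_of_eq0 (R : realType) (m : R) (eta : R -> R) (y : R) :
  0 < m -> classD m eta -> 2 * m <= `|y| -> bump_of m eta y = 0.
Proof.
move=> m_gt0 [_ _ eta0 eta1 _]; rewrite /bump_of ler_normr => /orP[] ym.
- by rewrite !eta1 ?subrr //; lra.
- by rewrite !eta0 ?subrr //; lra.
Qed.

(** The zeroth iterate of [derive_in A] is [g] itself; every later term carries a positive power of
    [x - x]. *)
Lemma taylor_in_base (R : realType) (A : set R) (r : nat) (g : R -> R) (x : R) :
  taylor_in A r g x x = g x.
Proof.
rewrite /taylor_in big_ord_recl /= expr0 mulr1 fact0 divr1 big1 ?addr0 // => i _.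
by rewrite subrr expr0n /= mulr0.
Qed.

(** Induction on [k]: the first step already gives [d1], and each further step is positive. *)
Lemma irregular_grid_gap (R : realType) (c d : R) (n : nat) (z : nat -> R)
    (d1 d2 : R) (i k : nat) :
  irregular_grid c d n z d1 d2 -> (i < k)%N -> (k <= n)%N -> d1 <= z k - z i.
Proof.
case=> _ _ [d1_gt0 _] step _; elim: k => // k IHk.
rewrite ltnS leq_eqVlt => ik kn; have /andP[d1k _] := step k kn.
case/orP: ik => [/eqP -> // | ik].
by have := IHk ik (ltnW kn); lra.
Qed.

Arguments irregular_grid_gap {R c d n z d1 d2 i k}.

(** This Kronecker delta evaluates both sums in [Ttilde]. *)
Lemma bump_of_grid (R : realType) (c d : R) (n : nat) (z : nat -> R)
    (d1 d2 m : R) (eta : R -> R) (j k : nat) :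
  irregular_grid c d n z d1 d2 -> 0 < m -> classD m eta ->
  (j <= n)%N -> (k <= n)%N ->
  bump_of m eta (2 * m / d1 * (z j - z k)) = (k == j)%:R.
Proof.
move=> hgrid m_gt0 heta jn kn.
have [_ _ [d1_gt0 _] _ _] := hgrid.
have [-> | kj] := eqVneq k j; first by rewrite subrr mulr0 bump_of0.
have gap : d1 <= `|z j - z k|.
  move: kj; rewrite neq_ltn => /orP[kj | jk].
  - exact: le_trans (irregular_grid_gap hgrid kj jn) (ler_norm _).
  - by rewrite distrC; apply: le_trans (irregular_grid_gap hgrid jk kn) (ler_norm _).
have m2_ge0 : 0 <= 2 * m by lra.
apply: bump_of_eq0 => //.
(* The factor [2 * m / d1] stretches a gap of [d1] to [2 * m]. *)
rewrite normrM ger0_norm ?divr_ge0 ?(ltW d1_gt0) //.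
by rewrite mulrAC ler_pdivlMr // ler_wpM2l.
Qed.

Arguments bump_of_grid {R c d n z d1 d2 m eta j k}.

Theorem theorem2p6 (R : realType) (c d : R) (n : nat) (z : nat -> R)
    (d1 d2 : R) (m : R) (eta : R -> R) (r : nat) (g : R -> R)
    (hgrid : irregular_grid c d n z d1 d2)
    (hm : 0 < m) (heta : classD m eta)
    (hr : (1 <= r)%N) (hg : Cr_itv c d r g) :
  forall j : nat, (j <= n)%N -> Ttilde m eta c d n z d1 r g (z j) = g (z j).
Proof.
move=> j jn.
have jn1 : (j < n.+1)%N by rewrite ltnS.
have bumpE (k : 'I_n.+1) :
    bump_of m eta (2 * m / d1 * (z j - z k)) = (k == Ordinal jn1)%:R.
  by rewrite (bump_of_grid hgrid) // -ltnS ltn_ord.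
rewrite /Ttilde.
(* The diagonal term is split off in the numerator, then in the denominator, which reduces to 1. *)
rewrite (bigD1 (Ordinal jn1)) //= [X in _ / X](bigD1 (Ordinal jn1)) //=.
rewrite !big1 => [|k kj|k kj]; try by rewrite bumpE (negPf kj) ?mul0r.
by rewrite (bumpE (Ordinal jn1)) eqxx !addr0 mul1r divr1 taylor_in_base.
Qed.
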